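(* If $\kappa$ is a cardinal with $\kappa<\mathfrak{d}$, then every countable subspace of $2^\kappa$ is S-separable.
   Context: A space $X$ is S-separable if for every sequence $(Y_n)_{n\in\mathbb{N}}$ of dense subspaces of $X$ there exists a sequence $(F_n)_{n\in\mathbb{N}}$ such that each $F_n$ is a finite subset of $Y_n$ and for each finite collection $\mathcal{F}$ of nonempty open sets of $X$ there exists $n\in\mathbb{N}$ with $U\cap F_n\neq\emptyset$ for all $U\in\mathcal{F}$. $2^\kappa$ is the Cantor cube: the product of $\kappa$ copies of the two-point discrete space $\{0,1\}$ with the product topology. $\mathfrak{d}$ is the dominating number: the least cardinality of a set $D\subseteq\mathbb{N}^{\mathbb{N}}$ such that for every $f\in\mathbb{N}^{\mathbb{N}}$ there is $g\in D$ with $f(n)\le g(n)$ for all but finitely many $n$. *)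

(* Defs.v *)
From mathcomp Require Import all_boot all_order.
From mathcomp Require Import boolp classical_sets functions cardinality.
From mathcomp Require Import topology.

Set Implicit Arguments.
Unset Strict Implicit.
Unset Printing Implicit Defensive.

Local Open Scope classical_set_scope.
Local Open Scope card_scope.

Definition S_separable (X : topologicalType) : Prop :=
  forall Y : nat -> set X, (forall n, dense (Y n)) ->
  exists F : nat -> set X,
    (forall n, finite_set (F n) /\ F n `<=` Y n) /\
    forall UU : set (set X), finite_set UU ->
      (forall U, UU U -> open U /\ U !=set0) ->
      exists n, forall U, UU U -> U `&` F n !=set0.

Definition cantor_cube (K : Type) : topologicalType := {ptws K -> bool}.

(* Cardinals are represented by sets, compared up to equipotence. *)
Definition card_lt T U (A : set T) (B : set U) : Prop :=
  (A #<= B) /\ (A #!= B).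

Definition dominating (D : set (nat -> nat)) : Prop :=
  forall f : nat -> nat,
  exists2 g, D g & cofinite_set [set n | (f n <= g n)%N].

(* Hönig's argument: by Zorn's lemma there is a maximal set of choice functions
   of the family P that pairwise differ at every B in P; by maximality it
   projects onto some A in P, and it injects into every B in P. *)
Lemma exists_card_min T (P : set (set T)) : P !=set0 ->
  exists2 A, P A & forall B, P B -> A #<= B.
Proof.
move=> [C0 PC0].
pose Q (S : set (set T -> T)) :=
  (forall x, S x -> forall B, P B -> B (x B)) /\
  (forall x y B, S x -> S y -> P B -> x B = y B -> x = y).
have [F FQ totF|S [[S1 S2] Smax]] := @Zorn_bigcup _ Q.
  split=> [x [A FA Ax]|x y B [A FA Ax] [A' FA' A'y] PB xy].
    by have [+ _] := FQ _ FA; apply.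
  have [AA'|A'A] := totF _ _ FA FA'.
    by have [_ inj] := FQ _ FA'; apply: (inj _ _ B) => //; exact: AA'.
  by have [_ inj] := FQ _ FA; apply: (inj _ _ B) => //; exact: A'A.
have [A PA Asurj] : exists2 A, P A & forall a, A a -> exists2 x, S x & x A = a.
  apply: contrapT => nA.
  have [z zP] : exists z : set T -> T,
      forall B, P B -> B (z B) /\ forall x, S x -> x B <> z B.
    have : forall B, exists b, P B -> B b /\ forall x, S x -> x B <> b.
      move=> B; have [PB|nPB] := pselect (P B); last first.
        have [[b _]|T0] := pselect ([set: T] !=set0); first by exists b.
        exfalso; apply: nA; exists C0 => // a _.
        by exfalso; apply: T0; exists a.
      apply: contrapT => nb; apply: nA; exists B => // a Ba.
      apply: contrapT => nx; apply: nb; exists a => _; split=> // x Sx xa.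
      by apply: nx; exists x.
    by move=> /choice[z zP]; exists z.
  apply: (Smax (S `|` [set z])).
    split=> [x|SE]; first by left.
    have Sz : S z by apply: SE; right.
    by have [_ /(_ _ Sz)] := zP _ PC0.
  split=> [x [Sx B PB|-> B PB]|x y B].
  - exact: (S1 x).
  - by have [] := zP _ PB.
  - move=> [Sx|->] [Sy|->] PB //.
    + exact: S2.
    + by have [_ /(_ _ Sx)] := zP _ PB.
    + by have [_ /(_ _ Sy) h /esym/h] := zP _ PB.
exists A => // B PB.
have [g gP] : exists g : T -> set T -> T, forall a, A a -> S (g a) /\ g a A = a.
  have : forall a, exists x : set T -> T, A a -> S x /\ x A = a.
    move=> a; have [/Asurj[x Sx xa]|nAa] := pselect (A a); first by exists x.
    by exists (fun=> a).
  by move=> /choice[g gP]; exists g.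
have ginj : {in A &, injective (fun a => g a B)}.
  move=> a b /set_mem Aa /set_mem Ab gab.
  have [[Sa ga] [Sb gb]] := (gP _ Aa, gP _ Ab).
  by rewrite -ga -gb (S2 _ _ B Sa Sb PB gab).
apply: (@card_le_trans _ _ _ ((fun a => g a B) @` A)).
  by have /card_eqPle[] := inj_card_eq ginj.
by apply: subset_card_le => _ [a Aa <-]; have [Sa _] := gP _ Aa; exact: (S1 (g a)).
Qed.

Lemma exists_dominating_min : exists2 D, dominating D &
  forall D', dominating D' -> D #<= D'.
Proof.
apply: exists_card_min; exists setT => f; exists f => //.
rewrite (_ : [set _ | _] = setT) ?setCT//.
by apply/seteqP; split=> n //= _; exact: leqnn.
Qed.

(* The dominating number, as a chosen dominating family of least cardinality. *)
Definition dominating_number : set (nat -> nat) :=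
  s2val (cid2 exists_dominating_min).

Lemma dominating_numberP : dominating dominating_number /\
  forall D, dominating D -> dominating_number #<= D.
Proof. by rewrite /dominating_number; case: cid2. Qed.

(* Main.v *)
(** The basic open sets of a subspace of the cube are indexed by finite sequences
    over [K * bool], so finite families of them are indexed by sequences of such
    sequences; the latter number at most [#|K|] if [K] is infinite, and are
    countable otherwise.  Enumerate the countable subspace.  Given dense sets
    [D n], a finite family [i] of nonempty basic open sets determines a function
    [f i] for which the points of [D n] with index at most [f i n] already meet
    every member of [i].  Fewer than the dominating number of functions are not
    dominating, so some [g] exceeds each [f i] at some [n], and the set of the
    points of [D n] with index below [g n] is the required finite set.  *)

Require Import Defs.
From mathcomp Require Import all_boot all_order.
From mathcomp Require Import boolp classical_sets functions cardinality.
From mathcomp Require Import topology.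
From HB Require Import structures.
Local Open Scope classical_set_scope.
Local Open Scope card_scope.

(** * Injections on subsets *)

Lemma card_le_inj_in (T U : Type) (u0 : U) (A : set T) (B : set U) :
  A #<= B -> exists h : T -> U,
    (forall x, A x -> B (h x)) /\ forall x y, A x -> A y -> h x = h y -> x = y.
Proof.
elim/Pchoice: U => U in u0 B *.
(* The point [u0] makes the target pointed, so that the embedding is given by a total function. *)
pose pU : pointedType := HB.pack (Choice.sort U) (isPointed.Build U u0).
move=> /(@pcard_leP T pU)[h]; exists h; split=> [x Ax|x y Ax Ay]; first exact: funS.
by apply: inj; rewrite inE.
Qed.

Lemma inj_in_map (T U : eqType) (A : set T) (f : T -> U) :
  (forall x y, A x -> A y -> f x = f y -> x = y) ->
  forall s t, [set` s] `<=` A -> [set` t] `<=` A -> map f s = map f t -> s = t.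
Proof.
move=> finj; elim=> [|x s IH] [|y t]//= sA tA [xy st]; congr (_ :: _).
  by apply: finj => //; [apply: sA|apply: tA] => /=; exact: mem_head.
by apply: IH => // z zs; [apply: sA|apply: tA]; rewrite /= inE; apply/orP; right.
Qed.

(** * Coding the finite sequences over an infinite set *)

Section SeqCoding.
Variable K : choiceType.
Implicit Types (G : set (seq K * K)) (A : set K).

(** The alphabet is read off from the one-letter sequences, so that a coding is a bare graph and
    Zorn's lemma applies under inclusion. *)
Definition coded G : set K := [set x | exists z, G ([:: x], z)].

(* The graph of an injection from the sequences over [coded G] to [coded G];
   the premise [coded G x] in the last clause makes the empty graph one too. *)
Definition seq_coding G :=
  [/\ forall s z z', G (s, z) -> G (s, z') -> z = z',
      forall s s' z, G (s, z) -> G (s', z) -> s = s',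
      forall s z, G (s, z) -> [set` s] `<=` coded G /\ coded G z &
      forall x s, coded G x -> [set` s] `<=` coded G -> exists z, G (s, z)].

Lemma coded_sub G G' : G `<=` G' -> coded G `<=` coded G'.
Proof. by move=> GG' x [z xz]; exists z; exact: GG'. Qed.

(** A sequence has finitely many letters, so some single member of the chain already has all of them
    in its alphabet. *)
Lemma seq_coding_bigcup (F : set (set (seq K * K))) :
  F `<=` seq_coding -> total_on F subset -> seq_coding (\bigcup_(G in F) G).
Proof.
move=> FQ Ftot.
have sub G : F G -> G `<=` \bigcup_(G in F) G by move=> FG p Gp; exists G.
have join G1 G2 : F G1 -> F G2 -> exists G, [/\ F G, G1 `<=` G & G2 `<=` G].
  by move=> F1 F2; have [G12|G21] := Ftot _ _ F1 F2; [exists G2|exists G1]; split.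
split=> [s z z' [G1 F1 s1] [G2 F2 s2]|s s' z [G1 F1 s1] [G2 F2 s2]|s z [G FG sz]|
         x s [z [G FG xz]] sF].
- have [G [/FQ[Gf _ _ _] G1G G2G]] := join _ _ F1 F2.
  by apply: (Gf s); [exact: G1G|exact: G2G].
- have [G [/FQ[_ Gi _ _] G1G G2G]] := join _ _ F1 F2.
  by apply: (Gi _ _ z); [exact: G1G|exact: G2G].
- have [_ _ Gd _] := FQ _ FG; have [sG zG] := Gd _ _ sz.
  have cG := coded_sub _ _ (sub _ FG); split=> [y /sG|]; exact: cG.
- have [G' [FG' GG' sG']] : exists G', [/\ F G', G `<=` G' & [set` s] `<=` coded G'].
    elim: s sF => [|y s IH] sF; first by exists G; split.
    have [|G1 [F1 GG1 sG1]] := IH.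
      by move=> w ws; apply: sF; rewrite /= inE; apply/orP; right.
    have [w [G2 F2 yw]] : coded (\bigcup_(G in F) G) y by apply: sF; exact: mem_head.
    have [G' [FG' G1G' G2G']] := join _ _ F1 F2; exists G'; split=> //.
      exact: subset_trans GG1 G1G'.
    move=> v /=; rewrite inE => /orP[/eqP->|vs]; first by exists w; exact: G2G'.
    by apply: (coded_sub _ _ G1G'); exact: sG1.
  have [_ _ _ Gt] := FQ _ FG'.
  have [|w sw] := Gt x s _ sG'; last by exists w, G'.
  by exists z; exact: GG'.
Qed.

(** Countability of the sequences of naturals, transported along [i]; this nonempty coding keeps the
    empty graph from being maximal. *)
Lemma seq_coding_range (i : nat -> K) : injective i ->
  seq_coding (range (fun t : seq nat => (map i t, i (pickle t)))).
Proof.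
move=> iinj; set G := range _.
have codedE : coded G = range i.
  apply/seteqP; split=> [x [z [[|n []] _ //= [<- _]]]|_ [n _ <-]]; first by exists n.
  by exists (i (pickle [:: n])), [:: n].
have pinj : injective (@pickle (seq nat)) := pcan_inj pickleK.
split.
- by move=> s _ _ [t _ [<- <-]] [t' _ [/(inj_map iinj)-> <-]].
- by move=> _ _ z [t _ [<- <-]] [t' _ [<- /iinj/pinj->]].
- move=> _ _ [t _ [<- <-]]; rewrite codedE; split; last by exists (pickle t).
  by move=> _ /mapP[n _ ->]; exists n.
- move=> x s _; rewrite codedE => si.
  suff [t <-] : exists t, map i t = s by exists (i (pickle t)), t.
  elim: s si => [|y s IH] si; first by exists [::].
  have [n _ <-] := si y (mem_head _ _).
  have [|t <-] := IH; first by move=> v vs; apply: si; rewrite /= inE; apply/orP; right.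
  by exists (n :: t).
Qed.

(* The points of [A] and those of [D `\` A] are sent to codes of sequences of
   length 1 and 2 respectively, so that their images are disjoint. *)
Lemma inj_into_of_seq_coding (q : seq K -> K) A (u : K -> K) (D : set K) :
  (forall s, [set` s] `<=` A -> A (q s)) ->
  (forall s t, [set` s] `<=` A -> [set` t] `<=` A -> q s = q t -> s = t) ->
  (forall x, D x -> ~ A x -> A (u x)) ->
  (forall x y, D x -> ~ A x -> D y -> ~ A y -> u x = u y -> x = y) ->
  exists e : K -> K, (forall x, D x -> A (e x)) /\
    forall x y, D x -> D y -> e x = e y -> x = y.
Proof.
move=> qA qinj uA uinj.
have sub1 x : A x -> [set` [:: x]] `<=` A.
  by move=> Ax y /=; rewrite inE => /eqP->.
have sub2 x : A x -> [set` [:: x; x]] `<=` A.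
  by move=> Ax y /=; rewrite !inE orbb => /eqP->.
exists (fun x => if x \in A then q [:: x] else q [:: u x; u x]).
split=> [x Dx|x y Dx Dy].
  case: ifPn => [/set_mem|]; rewrite ?notin_setE => Ax; apply: qA.
    exact: sub1.
  by apply: sub2; exact: uA.
case: ifPn => [/set_mem|]; rewrite ?notin_setE => Ax;
  case: ifPn => [/set_mem|]; rewrite ?notin_setE => Ay.
- by move=> /(qinj _ _ (sub1 _ Ax) (sub1 _ Ay))[].
- by move=> /(qinj _ _ (sub1 _ Ax) (sub2 _ (uA _ Dy Ay))).
- by move=> /(qinj _ _ (sub2 _ (uA _ Dx Ax)) (sub1 _ Ay)).
- move=> /(qinj _ _ (sub2 _ (uA _ Dx Ax)) (sub2 _ (uA _ Dy Ay)))[+ _].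
  exact: uinj.
Qed.

(* The sequences over [D] that are not sequences over [A] get codes in the
   disjoint copy [h @` A] of [A]. *)
Lemma seq_coding_extend G (q : seq K -> K) (h : K -> K) (e : K -> K) (a0 : K) :
  let A := coded G in let D := A `|` h @` A in
  seq_coding G -> A a0 -> (forall s, [set` s] `<=` A -> G (s, q s)) ->
  (forall x, A x -> ~ A (h x)) ->
  (forall x y, A x -> A y -> h x = h y -> x = y) ->
  (forall x, D x -> A (e x)) ->
  (forall x y, D x -> D y -> e x = e y -> x = y) ->
  exists2 G', G `<` G' & seq_coding G'.
Proof.
move=> A D [Gf Gi Gd Gt] Aa0 qG hA hinj eA einj.
have qA s : [set` s] `<=` A -> A (q s) by move=> /qG/Gd[].
have qinj s t : [set` s] `<=` A -> [set` t] `<=` A -> q s = q t -> s = t.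
  by move=> /qG sA /qG + qst; rewrite -qst; exact: Gi.
have mapA s : [set` s] `<=` D -> [set` map e s] `<=` A.
  by move=> sD _ /mapP[x xs ->]; apply: eA; exact: sD.
pose N := [set p : seq K * K | [/\ [set` p.1] `<=` D, ~ [set` p.1] `<=` A &
  p.2 = h (q (map e p.1))]].
have NE x : A x -> N ([:: h x], h (q [:: e (h x)])).
  move=> Ax; split=> //= [y|/(_ (h x))].
    by rewrite /= inE => /eqP->; right; exists x.
  by rewrite /= mem_head => /(_ isT); exact: hA.
have codedE : coded (G `|` N) = D.
  apply/seteqP; split=> [x [z [xz|[/= + _ _]]]|x [[z xz]|[y Ay <-]]].
  - by left; exists z.
  - by apply; exact: mem_head.
  - by exists z; left.
  - by exists (h (q [:: e (h y)])); right; exact: NE.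
exists (G `|` N).
  (* The one-letter sequence on [h a0] is coded in [N] but not in [G], as [h a0] lies outside
     [A]. *)
  split=> [p|GN]; first by left.
  have [] := Gd _ _ (GN _ (or_intror (NE _ Aa0))).
  by move=> /(_ (h a0) (mem_head _ _)) /(hA _ Aa0).
split.
- move=> s z z' [sz|[/= sD sA ->]] [sz'|[/= _ sA' ->]] //; first exact: Gf sz sz'.
    by have [] := Gd _ _ sz.
  by have [] := Gd _ _ sz'.
- move=> s s' z [sz|[/= sD _ ->]] [sz'|[/= sD' _]].
  + exact: Gi sz sz'.
  + by move=> zE; have [_] := Gd _ _ sz; rewrite zE => /(hA _ (qA _ (mapA _ sD'))).
  + by have [_ /(hA _ (qA _ (mapA _ sD)))] := Gd _ _ sz'.
  + move=> /hinj-/(_ (qA _ (mapA _ sD)) (qA _ (mapA _ sD'))).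
    move=> /qinj-/(_ (mapA _ sD) (mapA _ sD')).
    exact: (inj_in_map _ _ D).
- move=> s z; rewrite codedE => -[/Gd[sA Az]|[/= sD _ ->]].
    by split=> [y /sA|]; left.
  by split=> //; right; exists (q (map e s)) => //; exact/qA/mapA.
- move=> x s _; rewrite codedE => sD.
  have [sA|nsA] := pselect ([set` s] `<=` A); first by exists (q s); left; exact: qG.
  by exists (h (q (map e s))); right.
Qed.

Lemma infinite_seq_inj : infinite_set [set: K] ->
  exists c : seq K -> K, injective c.
Proof.
move=> Kinf; have [k0 _] := infinite_setN0 Kinf.
have [G [GQ Gmax]] := Zorn_bigcup seq_coding_bigcup.
pose A := coded G.
have [[a0 Aa0]|A0] := pselect (A !=set0); last first.
  (* If [A] is empty, so is [G], since all codes lie in [A]; the coding over a countably infinite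
     subset then extends it properly. *)
  have [i [_ iinj]] := card_le_inj_in _ _ k0 _ _ ((infiniteP [set: K]).1 Kinf).
  exfalso; apply: (Gmax _ _ (seq_coding_range i (fun x y => iinj x y I I))).
  have G0 : G = set0.
    apply/seteqP; split=> // -[s z] sz; apply: A0; exists z.
    by have [_ _ Gd _] := GQ; have [] := Gd _ _ sz.
  rewrite G0; split=> [p []//|sub0].
  by apply: (sub0 ([::], i (pickle (@nil nat)))); exists [::].
have [Gf Gi Gd Gt] := GQ.
have [q qG] : exists q : seq K -> K, forall s, [set` s] `<=` A -> G (s, q s).
  have : forall s, exists z, [set` s] `<=` A -> G (s, z).
    move=> s; have [/(Gt _ _ Aa0)[z sz]|nsA] := pselect ([set` s] `<=` A).
      by exists z.
    by exists k0.
  by move=> /choice[q qP]; exists q.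
have qA s : [set` s] `<=` A -> A (q s) by move=> /qG/Gd[].
have qinj s t : [set` s] `<=` A -> [set` t] `<=` A -> q s = q t -> s = t.
  by move=> /qG sA /qG + qst; rewrite -qst; exact: Gi.
(* Comparability of [A] with its complement: if [A] embeds in [~` A], then [G]
   extends, against maximality; otherwise [K] embeds in [A]. *)
have [M MA Mmin] :=
  @exists_card_min K [set A; ~` A] (ex_intro _ A (or_introl erefl)).
case: MA => ME; rewrite {}ME in Mmin.
  have [h [hA hinj]] := card_le_inj_in _ _ k0 _ _ (Mmin _ (or_intror erefl)).
  (* A left inverse of [h] on [A] sends the disjoint copy back into [A]. *)
  have [u uh] : exists u, forall x, A x -> u (h x) = x.
    have : forall y, exists x, forall x', A x' -> y = h x' -> x' = x.
      move=> y; have [[x Ax <-]|nx] := pselect ((h @` A) y).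
        by exists x => x' Ax' /esym; exact: hinj.
      by exists k0 => x Ax yx; exfalso; apply: nx; exists x.
    by move=> /choice[u uP]; exists u => x Ax; apply/esym; exact: (uP (h x)).
  have [| |e [eA einj]] := inj_into_of_seq_coding q A u (A `|` h @` A) qA qinj.
  - by move=> x [//|[y Ay <-]] _; rewrite uh.
  - by move=> x y [//|[x' Ax <-]] _ [//|[y' Ay <-]] _; rewrite !uh// => ->.
  by have [G' /Gmax] := seq_coding_extend G q h e a0 GQ Aa0 qG hA hinj eA einj.
have [v [vA vinj]] := card_le_inj_in _ _ k0 _ _ (Mmin _ (or_introl erefl)).
have [| |e [eA einj]] := inj_into_of_seq_coding q A v setT qA qinj.
- by move=> x _; exact: vA.
- by move=> x y _ nAx _ nAy; exact: vinj.
have mapA s : [set` map e s] `<=` A by move=> _ /mapP[x _ ->]; exact: eA.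
exists (q \o map e) => s t /= /qinj-/(_ (mapA s) (mapA t)).
by apply: (inj_in_map _ _ setT).
Qed.

End SeqCoding.

(** * Families too small to be dominating *)

Lemma not_dominated_countable (I : countType) (f : I -> nat -> nat) :
  exists g : nat -> nat, forall i, exists n, (f i n < g n)%N.
Proof.
(* At [n = pickle i] the sum contains the term of [i] itself; the outer successor makes the
   inequality strict. *)
exists (fun n => (\sum_(m < n.+1) oapp f (fun=> 0) (unpickle m) n).+1)%N => i.
exists (pickle i); rewrite ltnS big_ord_recr/= pickleK/=.
exact: leq_addl.
Qed.

(** Otherwise every function lies everywhere below some [f i], so the image of [f] is dominating and
    [I] is too large. *)
Lemma not_dominated_lt (I : Type) (f : I -> nat -> nat) :
  card_lt [set: I] dominating_number ->
  exists g : nat -> nat, forall i, exists n, (f i n < g n)%N.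
Proof.
move=> [Ile /negP Ine]; apply: contrapT => nog; apply: Ine.
apply: Cantor_Bernstein => //.
apply: (@card_le_trans _ _ _ (f @` setT)); last exact: card_image_le.
apply: (dominating_numberP.2) => g.
have [i fi] : exists i, forall n, (g n <= f i n)%N.
  apply: contrapT => ni; apply: nog; exists g => i.
  apply: contrapT => nn; apply: ni; exists i => n.
  by rewrite leqNgt; apply/negP => gn; apply: nn; exists n.
exists (f i); first by exists i.
by rewrite (_ : [set _ | _] = setT) ?setCT//; apply/seteqP; split=> // n _; exact: fi.
Qed.

Lemma not_dominated_seqs (K : Type) (f : seq (seq (K * bool)) -> nat -> nat) :
  card_lt [set: K] dominating_number ->
  exists g : nat -> nat, forall i, exists n, (f i n < g n)%N.
Proof.
move=> [Kle Kne].
have [Kfin|Kinf] := pselect (finite_set [set: K]).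
  have [L LK] := Pcountable (finite_set_countable Kfin).
  subst K.
  exact: not_dominated_countable.
elim/Pchoice: K => K in f Kle Kne Kinf *.
have [c cinj] := infinite_seq_inj K Kinf.
(* The Boolean is encoded by the length, 1 or 2, of a constant sequence. *)
pose b (kb : K * bool) := c (nseq kb.2.+1 kb.1).
have binj : injective b by move=> [k [] ] [l []] /cinj//= [->].
pose d s := c (map (c \o map b) s).
have dinj : injective d.
  by move=> s t /cinj; apply/inj_map => {}s {}t /cinj; exact: inj_map.
have IK : [set: seq (seq (K * bool))] #<= [set: K].
  rewrite -(card_le_eql (inj_card_eq (in2W dinj))).
  exact: card_leT.
apply: not_dominated_lt; split; first exact: card_le_trans Kle.
apply: contra Kne => /card_eqPle[_ dI].
exact: Cantor_Bernstein Kle (card_le_trans dI IK).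
Qed.

(** * Basic open sets of the cube *)

Section CantorCube.
Variable K : choiceType.

(** A list may prescribe both values at one coordinate; its cylinder is then empty. *)
Definition cylinder (l : seq (K * bool)) : set (cantor_cube K) :=
  [set y | all (fun kb => y kb.1 == kb.2) l].

Lemma open_cylinder l : open (cylinder l).
Proof.
elim: l => [|[k b] l IH].
  by rewrite (_ : cylinder _ = setT); [exact: openT|exact/seteqP].
rewrite (_ : cylinder _ = (@^~ k) @^-1` [set b] `&` cylinder l).
  apply: openI => //; apply: open_comp.
    by move=> y _; exact: (@proj_continuous K (fun=> bool)).
  exact: discrete_open.
apply/seteqP; split=> y /=; rewrite /cylinder/=.
  by move=> /andP[/eqP].
by move=> [-> ->]; rewrite eqxx.
Qed.

Lemma nbhs_cylinder (x : cantor_cube K) (U : set (cantor_cube K)) : nbhs x U ->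
  exists2 l, cylinder l x & cylinder l `<=` U.
Proof.
pose B := [set l | cylinder l x].
have FB : Filter (filter_from B cylinder).
  apply: filter_from_filter; first by exists [::].
  move=> l l' xl xl'; exists (l ++ l').
    by rewrite /B/= /cylinder/= all_cat; apply/andP.
  by move=> y; rewrite /cylinder/= all_cat => /andP.
suff : filter_from B cylinder --> x.
  by move=> /[apply] -[l Bl lU]; exists l.
(* The product topology is a supremum over the coordinates, so convergence is checked at one
   coordinate [k], where fixing the value [x k] is enough. *)
apply/cvg_sup => k V [_ [[W oW <-] Wx] WV].
exists [:: (k, x k)]; first by rewrite /B/= /cylinder/= eqxx.
by move=> y; rewrite /cylinder/= andbT => /eqP yx; apply: WV; rewrite /= yx.
Qed.

End CantorCube.

Theorem corollary3p18 (K : Type) (hK : card_lt [set: K] dominating_number)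
  (Y : set (cantor_cube K)) (hY : countable Y) :
  S_separable (set_type Y).
Proof.
elim/Pchoice: K => K in hK Y hY *.
move=> D Ddense.
have /countable_injP[e0 e0inj] := hY.
pose e (x : set_type Y) := e0 (val x).
have einj : injective e.
  by move=> x y /e0inj xy; apply: val_inj; apply: xy; exact: valP.
pose B (l : seq (K * bool)) : set (set_type Y) := val @^-1` cylinder K l.
have oB l : open (B l) by exists (cylinder K l) => //; exact: open_cylinder.
have [f fP] : exists f : seq (seq (K * bool)) -> nat -> nat, forall i n l,
    l \in i -> B l !=set0 -> exists2 x, (B l `&` D n) x & (e x <= f i n)%N.
  have h l : exists f : nat -> nat, forall n, B l !=set0 ->
      exists2 x, (B l `&` D n) x & (e x <= f n)%N.
    suff /choice[f fP] : forall n, exists m, B l !=set0 ->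
      exists2 x, (B l `&` D n) x & (e x <= m)%N by exists f.
    move=> n; have [Bl0|nBl] := pselect (B l !=set0); last by exists 0.
    by have [x Bx] := Ddense n _ Bl0 (oB l); exists (e x) => _; exists x.
  have [f0 f0P] := choice h.
  (* The maximum gives one bound that serves all members of [i]. *)
  exists (fun i n => \max_(l <- i) f0 l n)%N => i n l li Bl0.
  have [x Bx ex] := f0P l n Bl0; exists x => //.
  apply: (leq_trans ex); exact: (@leq_bigmax_seq _ i xpredT (fun l => f0 l n)).
have [g gP] := not_dominated_seqs _ f hK.
exists (fun n => D n `&` [set x | e x < g n]%N); split=> [n|UU UUfin UUopen].
  split; last by move=> x [].
  (* Injectivity of [e] leaves at most [g n] points of index below [g n]. *)
  apply: finite_setIr.
  apply: (@card_le_finite _ _ _ `I_(g n)); last exact: finite_II.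
  rewrite -(card_le_eql (inj_card_eq (in2W einj))).
  by apply: subset_card_le => _ [x /= xg <-].
(* Shrinking the members of [UU] to nonempty basic open sets turns the family into an index for
   [f]. *)
have [b bP] : exists b : set (set_type Y) -> seq (K * bool),
    forall U, UU U -> B (b U) !=set0 /\ B (b U) `<=` U.
  suff /choice[b bP] : forall U, exists l, UU U -> B l !=set0 /\ B l `<=` U.
    by exists b.
  move=> U; have [/UUopen[oU [x Ux]]|nU] := pselect (UU U); last by exists [::].
  case: oU => V oV VU.
  have [|l lx lV] := nbhs_cylinder K (val x) V.
    by apply: open_nbhs_nbhs; split=> //; rewrite -VU in Ux.
  by exists l => _; split; [exists x|rewrite -VU => y; exact: lV].
have [s sE] := (finite_seqP _).1 UUfin.
have [n fg] := gP (map b s); exists n => U UUU.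
have [b0 bU] := bP _ UUU.
have [|x [Bx Dx] ex] := fP (map b s) n (b U) _ b0.
  by apply: map_f; rewrite sE in UUU.
by exists x; split; [exact: bU|split=> //; exact: leq_ltn_trans fg].
Qed.
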